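(* Consider deterministic OGDA with step sizes $0<\eta_x\le\frac{1}{50\kappa^2\ell}$, $\eta_y=\frac1{6\ell}$, or deterministic EG with step sizes $0<\eta_x\le\frac1{75\kappa^2\ell}$, $\eta_y=\frac1{4\ell}$, where $\kappa=\ell/\mu$. There is a constant $c>0$ depending only on $\ell$ such that for all $\ell\ge\mu>0$, all $\Delta>0$ and all sufficiently small $\epsilon>0$ there exist a function $f(\cdot,\cdot)$ that is $\ell$-gradient Lipschitz (i.e. $\ell$-smooth) and $\mu$-strongly concave in $y$, and an initialization $(x_0,y_0)$ with $\Delta_\Phi=\Delta$, such that for each of the two methods the following holds: if $\bar x$ is the solution returned after $T$ iterations and $\|\nabla\Phi(\bar x)\|\le\epsilon$, then $$T\ \ge\ c\,\frac{\kappa^2\Delta_\Phi}{\epsilon^2}.$$ (That is, both methods require $T=\Omega(\kappa^2\Delta_\Phi/\epsilon^2)$ iterations to guarantee $\|\nabla\Phi(\bar x)\|\le\epsilon$.)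
   Context: $f$ is $\ell$-smooth if it is differentiable and $\|\nabla f(x_1,y_1)-\nabla f(x_2,y_2)\|^2\le \ell^2\|x_1-x_2\|^2+\ell^2\|y_1-y_2\|^2$. $\Phi(x)=\max_yf(x,y)$, and $\Delta_\Phi=\max(\Phi(x_1),\Phi(x_0))-\min_x\Phi(x)$. The dual variable is unconstrained. OGDA (with $(x_{-1},y_{-1})=(x_0,y_0)$), $t\ge 0$: $x_{t+1}=x_t-\eta_x\nabla_xf(x_t,y_t)-\eta_x(\nabla_xf(x_t,y_t)-\nabla_xf(x_{t-1},y_{t-1}))$, $y_{t+1}=y_t+\eta_y\nabla_yf(x_t,y_t)+\eta_y(\nabla_yf(x_t,y_t)-\nabla_yf(x_{t-1},y_{t-1}))$. EG, $t\ge0$: $x_{t+1/2}=x_t-\eta_x\nabla_xf(x_t,y_t)$, $y_{t+1/2}=y_t+\eta_y\nabla_yf(x_t,y_t)$, $x_{t+1}=x_t-\eta_x\nabla_xf(x_{t+1/2},y_{t+1/2})$, $y_{t+1}=y_t+\eta_y\nabla_yf(x_{t+1/2},y_{t+1/2})$. The returned $\bar x$ is chosen at random from $x_1,\dots,x_T$. *)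

(* Defs.v *)
From HB Require Import structures.
From mathcomp Require Import all_boot all_order all_algebra.
From mathcomp Require Import all_classical all_reals all_analysis.
Set Implicit Arguments.
Unset Strict Implicit.
Unset Printing Implicit Defensive.
Import Order.TTheory GRing.Theory Num.Theory.
Import numFieldNormedType.Exports.
Local Open Scope classical_set_scope.
Local Open Scope ring_scope.

(* The library norm `|v| on 'rV[R]_n is the sup norm, which is why the squared
   Euclidean norm is defined separately.  Differentiability does not depend on
   this choice. *)
Definition enorm2 (R : realType) n (v : 'rV[R]_n) : R := \sum_i v 0 i ^+ 2.

Definition enorm (R : realType) n (v : 'rV[R]_n) : R := Num.sqrt (enorm2 v).

Definition gradient (R : realType) n (g : 'rV[R]_n -> R) (v : 'rV[R]_n) :
  'rV[R]_n := \row_i 'D_(delta_mx 0 i) g v.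

Definition gradx (R : realType) m n (f : 'rV[R]_m -> 'rV[R]_n -> R) x y :=
  gradient (fun x' => f x' y) x.

Definition grady (R : realType) m n (f : 'rV[R]_m -> 'rV[R]_n -> R) x y :=
  gradient (f x) y.

(* Joint (Frechet) differentiability and Lipschitz full gradient; the squared
   norm of a difference of full gradients is the sum over the two blocks. *)
Definition smooth (R : realType) m n (l : R)
    (f : 'rV[R]_m -> 'rV[R]_n -> R) : Prop :=
  (forall z : 'rV[R]_m * 'rV[R]_n,
     differentiable (fun w : 'rV[R]_m * 'rV[R]_n => f w.1 w.2) z) /\
  (forall x1 x2 y1 y2,
     enorm2 (gradx f x1 y1 - gradx f x2 y2)
     + enorm2 (grady f x1 y1 - grady f x2 y2)
     <= l ^+ 2 * enorm2 (x1 - x2) + l ^+ 2 * enorm2 (y1 - y2)).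

Definition strongly_concave (R : realType) n (mu : R) (g : 'rV[R]_n -> R) :
    Prop :=
  forall (a : R) y1 y2, 0 <= a <= 1 ->
    a * g y1 + (1 - a) * g y2 + mu / 2 * (a * (1 - a)) * enorm2 (y1 - y2)
    <= g (a *: y1 + (1 - a) *: y2).

Definition is_max (R : realType) (A : set R) (v : R) : Prop :=
  A v /\ ubound A v.

Definition is_min (R : realType) (A : set R) (v : R) : Prop :=
  A v /\ lbound A v.

Definition is_primal (R : realType) m n (f : 'rV[R]_m -> 'rV[R]_n -> R)
    (Phi : 'rV[R]_m -> R) : Prop :=
  forall x, is_max (range (f x)) (Phi x).

(* The initial gap Delta_Phi; requires the minimum of Phi to be attained. *)
Definition is_gap (R : realType) m (Phi : 'rV[R]_m -> R) (x0 x1 : 'rV[R]_m)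
    (D : R) : Prop :=
  exists2 p, is_min (range Phi) p & D = Num.max (Phi x1) (Phi x0) - p.

(* A state is the pair (current iterate, previous iterate). *)
Definition ogda_step (R : realType) m n (f : 'rV[R]_m -> 'rV[R]_n -> R)
    (ex ey : R)
    (s : ('rV[R]_m * 'rV[R]_n) * ('rV[R]_m * 'rV[R]_n)) :=
  let: ((x, y), (xp, yp)) := s in
  ((x - ex *: gradx f x y - ex *: (gradx f x y - gradx f xp yp),
    y + ey *: grady f x y + ey *: (grady f x y - grady f xp yp)),
   (x, y)).

Definition ogda (R : realType) m n (f : 'rV[R]_m -> 'rV[R]_n -> R)
    (ex ey : R) x0 y0 (t : nat) : 'rV[R]_m * 'rV[R]_n :=
  (iter t (ogda_step f ex ey) ((x0, y0), (x0, y0))).1.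

Definition eg_step (R : realType) m n (f : 'rV[R]_m -> 'rV[R]_n -> R)
    (ex ey : R) (s : 'rV[R]_m * 'rV[R]_n) :=
  let: (x, y) := s in
  let xh := x - ex *: gradx f x y in
  let yh := y + ey *: grady f x y in
  (x - ex *: gradx f xh yh, y + ey *: grady f xh yh).

Definition eg (R : realType) m n (f : 'rV[R]_m -> 'rV[R]_n -> R)
    (ex ey : R) x0 y0 (t : nat) : 'rV[R]_m * 'rV[R]_n :=
  iter t (eg_step f ex ey) (x0, y0).

(* The possible realizations of the point drawn at random from the primal
   iterates x_1, ..., x_T. *)
Definition returned (R : realType) m n (z : nat -> 'rV[R]_m * 'rV[R]_n)
    (T : nat) (xbar : 'rV[R]_m) : Prop :=
  exists2 t : nat, (1 <= t <= T)%N & xbar = (z t).1.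

Definition needs_iterations (R : realType) m n (Phi : 'rV[R]_m -> R)
    (z : nat -> 'rV[R]_m * 'rV[R]_n) (eps B : R) : Prop :=
  forall (T : nat) (xbar : 'rV[R]_m), returned z T xbar ->
    enorm (gradient Phi xbar) <= eps -> B <= T%:R.

(* Main.v *)
Require Import Defs.
From mathcomp Require Import all_boot all_order all_algebra.
From mathcomp Require Import all_classical all_reals all_analysis.
From mathcomp Require Import ring lra.
Set Implicit Arguments.
Unset Strict Implicit.
Unset Printing Implicit Defensive.
Import Order.TTheory GRing.Theory Num.Theory.
Import numFieldNormedType.Exports.
Local Open Scope ring_scope.

(** The two variables of the hard instance need not interact: take
    f (x, y) = h (x_0) - mu/2 |y|^2, whose primal function is h (x_0), with
    h (s) = A (sqrt (s^2 + a^2) - a), A = 2 eps and a = 2 eps / l.  The slope of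
    h never exceeds 2 eps, so an iteration moves x_0 by at most 6 etax eps,
    while |h' (s)| <= eps forces |s| <= a.  Starting at height Delta, that is at
    x_0 >= Delta / (2 eps), the iterate has to travel a distance of order
    Delta / eps, and etax = O(1 / (kappa^2 l)) gives the bound. *)

(** * One-variable calculus of the smoothed absolute value *)

Section SoftAbs.
Context {R : realType}.
Implicit Types A a x y : R.

Definition hyp a x : R := Num.sqrt (x ^+ 2 + a ^+ 2).

Definition soft_abs A a x : R := A * (hyp a x - a).

Definition soft_slope A a x : R := A * x / hyp a x.

Lemma hyp_arg_gt0 a x : 0 < a -> 0 < x ^+ 2 + a ^+ 2.
Proof. by move=> a0; rewrite ltr_wpDl ?sqr_ge0 ?exprn_gt0. Qed.

Lemma hyp_gt0 a x : 0 < a -> 0 < hyp a x.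
Proof. by move=> a0; rewrite sqrtr_gt0 hyp_arg_gt0. Qed.

Lemma sqr_hyp a x : 0 < a -> hyp a x ^+ 2 = x ^+ 2 + a ^+ 2.
Proof. by move=> a0; rewrite sqr_sqrtr// ltW// hyp_arg_gt0. Qed.

Lemma hyp_ge a x : 0 < a -> a <= hyp a x.
Proof.
move=> a0; have := hyp_gt0 x a0; have := sqr_hyp x a0; nra.
Qed.

Lemma ler_norm_hyp a x : 0 < a -> `|x| <= hyp a x.
Proof.
move=> a0; rewrite -sqrtr_sqr ler_sqrt; last exact/ltW/hyp_arg_gt0.
by rewrite lerDl sqr_ge0.
Qed.

Lemma soft_abs0 A a : 0 < a -> soft_abs A a 0 = 0.
Proof.
by move=> a0; rewrite /soft_abs /hyp expr0n add0r sqrtr_sqr gtr0_norm// subrr mulr0.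
Qed.

Lemma soft_abs_ge0 A a x : 0 <= A -> 0 < a -> 0 <= soft_abs A a x.
Proof. by move=> A0 a0; rewrite mulr_ge0// subr_ge0 hyp_ge. Qed.

Lemma ler_soft_abs A a x y : 0 <= A -> `|x| <= `|y| ->
  soft_abs A a x <= soft_abs A a y.
Proof.
move=> A0 xy; rewrite ler_wpM2l// lerD2r ler_wsqrtr// lerD2r.
by rewrite -(real_normK (num_real x)) -(real_normK (num_real y)) lerXn2r ?nnegrE.
Qed.

Lemma soft_slope_bound A a x : 0 <= A -> 0 < a -> `|soft_slope A a x| <= A.
Proof.
move=> A0 a0; have h0 := hyp_gt0 x a0.
rewrite !normrM normfV (ger0_norm A0) (gtr0_norm h0) -mulrA.
by rewrite ler_piMr// ler_pdivrMr// mul1r ler_norm_hyp.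
Qed.

(** The hypothesis says [2 * |x| <= hyp a x]; squaring gives [3 * x ^+ 2 <= a ^+ 2], so the bound
    has room to spare. *)
Lemma soft_slope_small A a x : 0 < A -> 0 < a ->
  `|soft_slope A a x| <= A / 2 -> `|x| <= a.
Proof.
move=> A0 a0; have h0 := hyp_gt0 x a0.
rewrite !normrM normfV (gtr0_norm A0) (gtr0_norm h0) -mulrA ler_pM2l//.
rewrite ler_pdivrMr// => xh.
have := sqr_hyp x a0; have := normr_ge0 x; rewrite -(real_normK (num_real x)); nra.
Qed.

Lemma soft_slope_lipschitz A a x y : 0 < A -> 0 < a ->
  (soft_slope A a x - soft_slope A a y) ^+ 2 <= (A / a) ^+ 2 * (x - y) ^+ 2.
Proof.
move=> A0 a0; rewrite /soft_slope.
have u0 := hyp_gt0 x a0; have v0 := hyp_gt0 y a0.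
have u2 := sqr_hyp x a0; have v2 := sqr_hyp y a0.
have ua := hyp_ge x a0; have va := hyp_ge y a0.
set u := hyp a x in u0 u2 ua *; set v := hyp a y in v0 v2 va *.
(* Multiplying numerator and denominator of [x / u - y / v] by [u + v] and replacing [u ^+ 2],
   [v ^+ 2] lets [x - y] factor out exactly, with cofactor [q]. *)
pose q := (u * v + a ^+ 2 - x * y) / (u * v * (u + v)).
have -> : A * x / u - A * y / v = A * ((x - y) * q).
  rewrite /q; have -> : u * v + a ^+ 2 - x * y = v * (u + v) - y * (x + y).
    by ring: v2.
  suff E : (x - y) * (v * (u + v) - y * (x + y)) = (x * v - y * u) * (u + v).
    rewrite [(x - y) * _]mulrA E; field; lra.
  by ring: u2 v2.
(* Lagrange's identity: the gap between the two sides is [(a * (x + y)) ^+ 2]. Hence the numerator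
   of [q] lies between 0 and [2 * (u * v)], and [u + v >= 2 * a] yields [q <= a^-1]. *)
have xyuv : (a ^+ 2 - x * y) ^+ 2 <= (u * v) ^+ 2.
  by rewrite exprMn u2 v2; have := sqr_ge0 (a * (x + y)); lra.
have uv0 : 0 < u * v by rewrite mulr_gt0.
have : `|a ^+ 2 - x * y| <= u * v.
  by rewrite -(ger0_norm (ltW uv0)) -ler_sqr ?nnegrE// !real_normK ?num_real.
rewrite ler_norml => /andP[lo hi].
have q0 : 0 <= q by rewrite divr_ge0 ?mulr_ge0//; lra.
have qa : q <= a^-1.
  rewrite /q ler_pdivrMr ?mulr_gt0 ?addr_gt0// ler_pdivlMl//.
  have : 0 <= u * v * (u + v - 2 * a) by rewrite mulr_ge0 ?(ltW uv0)//; lra.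
  by have : a * (u * v + a ^+ 2 - x * y) <= a * (2 * (u * v));
    [rewrite ler_pM2l//; lra | lra].
have {qa} : q ^+ 2 <= a^-1 ^+ 2 by rewrite lerXn2r ?nnegrE ?invr_ge0 ?(ltW a0).
move: (q) => p pa; rewrite !exprMn [(x - y) ^+ 2 * _]mulrC mulrA.
by rewrite ler_wpM2r ?sqr_ge0// ler_wpM2l ?sqr_ge0.
Qed.

Global Instance is_derive_soft_abs A a x : 0 < a ->
  is_derive x (1 : R) (soft_abs A a) (soft_slope A a x).
Proof.
move=> a0.
have -> : soft_abs A a =
  A \*: ((@Num.sqrt R \o (id ^+ 2 + cst (a ^+ 2))) - cst a).
  by apply/funext => s; rewrite /soft_abs /hyp /= !fctE.
have := hyp_arg_gt0 x a0 => xa.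
have D : is_derive ((id ^+ 2 + cst (a ^+ 2)) x) (1 : R) (@Num.sqrt R)
    (2 * hyp a x)^-1 by rewrite !fctE /hyp; exact: is_derive1_sqrt.
apply: is_derive_eq.
rewrite /soft_slope /GRing.scale /=; field.
by rewrite gt_eqF// hyp_gt0.
Qed.

Lemma soft_abs_preimage A a D : 0 < A -> 0 < a -> 0 < D ->
  exists2 x, D / A <= x & soft_abs A a x = D.
Proof.
move=> A0 a0 D0; have d0 : 0 < D / A by rewrite divr_gt0.
set d := D / A in d0 *.
(* The positive solution of [hyp a x = d + a]; its square is [d ^+ 2 + 2 * a * d >= d ^+ 2]. *)
exists (Num.sqrt ((d + a) ^+ 2 - a ^+ 2)).
  rewrite -{1}(ger0_norm (ltW d0)) -sqrtr_sqr ler_wsqrtr//; nra.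
rewrite /soft_abs /hyp sqr_sqrtr; last by nra.
rewrite subrK sqrtr_sqr gtr0_norm ?addr_gt0// addrK /d.
by rewrite mulrCA divff ?mulr1// gt_eqF.
Qed.

End SoftAbs.

(** Both sides are limits of the same difference quotient. This turns partial derivatives into
    one-variable ones, which [is_derive] instances can compute. *)
Lemma derive_line (R : realType) (V : normedModType R) (g : V -> R) (x v : V) :
  'D_v g x = 'D_1 (fun t : R => g (t *: v + x)) 0.
Proof.
rewrite /derive; set d := (X in fmap X); set d' := (X in _ = lim (fmap X _)).
suff -> : d = d' by [].
apply/funext => t; rewrite /d /d' /=.
by rewrite addr0 scale0r add0r [t *: 1]mulr1.
Qed.

(** * The squared Euclidean norm *)

Section Enorm2.
Context {R : realType} {n : nat}.
Implicit Types y z : 'rV[R]_n.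

Lemma enorm2_ge0 y : 0 <= enorm2 y.
Proof. by apply: sumr_ge0 => i _; rewrite sqr_ge0. Qed.

Lemma enorm2Z (b : R) y : enorm2 (b *: y) = b ^+ 2 * enorm2 y.
Proof. by rewrite /enorm2 mulr_sumr; apply: eq_bigr => i _; rewrite mxE exprMn. Qed.

Lemma enorm2_delta (i : 'I_n) : enorm2 (delta_mx 0 i : 'rV[R]_n) = 1.
Proof.
rewrite /enorm2 (bigD1 i)//= big1 ?addr0 ?mxE ?eqxx ?expr1n// => j ji.
by rewrite mxE (negPf ji) expr0n.
Qed.

Lemma enorm2_line (i : 'I_n) y (t : R) :
  enorm2 (t *: delta_mx 0 i + y) = enorm2 y + 2 * y 0 i * t + t ^+ 2.
Proof.
rewrite /enorm2 (bigD1 i)//= [in RHS](bigD1 i)//= !mxE !eqxx mulr1.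
rewrite (eq_bigr (fun j => y 0 j ^+ 2)); first by ring.
by move=> j ji; rewrite !mxE (negPf ji) mulr0 add0r.
Qed.

Lemma enorm2_convex (b : R) y z :
  enorm2 (b *: y + (1 - b) *: z) =
  b * enorm2 y + (1 - b) * enorm2 z - b * (1 - b) * enorm2 (y - z).
Proof.
rewrite /enorm2 !mulr_sumr -big_split/= -sumrB.
by apply: eq_bigr => i _; rewrite !mxE; ring.
Qed.

End Enorm2.

(** * The separable hard instance and its primal function *)

Section Separable.
Context {R : realType} {m n : nat}.
Variables (A a mu : R).
Hypotheses (A0 : 0 < A) (a0 : 0 < a).
Implicit Types (x : 'rV[R]_m.+1) (y : 'rV[R]_n).

Definition sep_primal x : R := soft_abs A a (x 0 0).

Definition sep x y : R := sep_primal x - mu / 2 * enorm2 y.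

Lemma gradient_soft_abs_coord (C : R) x :
  gradient (fun x' : 'rV[R]_m.+1 => soft_abs A a (x' 0 0) - C) x =
  soft_slope A a (x 0 0) *: delta_mx 0 0.
Proof.
apply/rowP => i; rewrite !mxE eqxx /= derive_line.
have -> : (fun t : R => soft_abs A a ((t *: delta_mx 0 i + x) 0 0) - C) =
    (soft_abs A a \o ((i == 0)%:R \*: id + cst (x 0 0))) - cst C.
  apply/funext => t; rewrite /= !fctE /= !mxE eqxx eq_sym.
  by rewrite [_ *: t]mulrC.
have D : is_derive (((i == 0)%:R \*: id + cst (x 0 0)) 0) (1 : R)
    (soft_abs A a) (soft_slope A a (x 0 0)).
  rewrite !fctE /= scaler0 add0r; exact: is_derive_soft_abs.
rewrite derive_val subr0 addr0; congr (_ * _).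
by rewrite /GRing.scale /= mulr1.
Qed.

Lemma gradx_sep x y : gradx sep x y = soft_slope A a (x 0 0) *: delta_mx 0 0.
Proof. exact: gradient_soft_abs_coord. Qed.

Lemma gradient_sep_primal x :
  gradient sep_primal x = soft_slope A a (x 0 0) *: delta_mx 0 0.
Proof.
rewrite -(gradient_soft_abs_coord 0); congr gradient.
by apply/funext => x'; rewrite subr0.
Qed.

Lemma grady_sep x y : grady sep x y = - mu *: y.
Proof.
apply/rowP => i; rewrite !mxE derive_line.
have -> : (fun t : R => sep x (t *: delta_mx 0 i + y)) =
    cst (sep x y) - (mu / 2) \*: ((2 * y 0 i) \*: id + id ^+ 2).
  apply/funext => t; rewrite /sep enorm2_line !fctE /=.
  rewrite [RHS](_ : _ = sep_primal x - mu / 2 * enorm2 y -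
    mu / 2 * (2 * y 0 i * t + t ^+ 2)) //; ring.
by rewrite derive_val /GRing.scale /=; field.
Qed.

Lemma differentiable_sep (z : 'rV[R]_m.+1 * 'rV[R]_n) :
  differentiable (fun w : 'rV[R]_m.+1 * 'rV[R]_n => sep w.1 w.2) z.
Proof.
have dfst : differentiable
    (fst : 'rV[R]_m.+1 * 'rV[R]_n -> 'rV[R]_m.+1) z.
  by apply: linear_differentiable => w; exact: cvg_fst.
have dsnd : differentiable (snd : 'rV[R]_m.+1 * 'rV[R]_n -> 'rV[R]_n) z.
  by apply: linear_differentiable => w; exact: cvg_snd.
have -> : (fun w : 'rV[R]_m.+1 * 'rV[R]_n => sep w.1 w.2) =
    (soft_abs A a \o ((fun x : 'rV[R]_m.+1 => x 0 0) \o fst)) -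
    (mu / 2) \*: \sum_i ((fun y : 'rV[R]_n => y 0 i) \o snd) ^+ 2.
  apply/funext => w; rewrite /sep /sep_primal !fctE /=; congr (_ - _ * _).
  by rewrite /enorm2 fct_sumE.
apply: differentiableB.
  apply: differentiable_comp.
    by apply: differentiable_comp => //; exact: differentiable_coord.
  by apply/derivable1_diffP; have := is_derive_soft_abs A (z.1 0 0) a0; case.
apply: differentiableZ; apply: differentiable_sum => i.
apply: differentiableX.
by apply: differentiable_comp => //; exact: differentiable_coord.
Qed.

(** The gradient blocks decouple: the [x]-block has Lipschitz constant [A / a], and the [y]-block is
    linear with factor [- mu]. *)
Lemma sep_smooth l : A / a = l -> 0 <= mu <= l -> smooth l sep.
Proof.
move=> Al /andP[mu0 mul]; split; first exact: differentiable_sep.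
move=> x1 x2 y1 y2; rewrite !gradx_sep !grady_sep.
rewrite -scalerBl -scalerBr !enorm2Z enorm2_delta mulr1 sqrrN.
apply: lerD; last by rewrite ler_wpM2r ?enorm2_ge0// lerXn2r ?nnegrE//; lra.
apply: le_trans (soft_slope_lipschitz _ _ A0 a0) _.
rewrite Al ler_wpM2l ?sqr_ge0// /enorm2 (bigD1 0)//= !mxE lerDl.
by apply: sumr_ge0 => i _; rewrite sqr_ge0.
Qed.

Lemma sep_strongly_concave x : strongly_concave mu (sep x).
Proof. by move=> b y1 y2 _; rewrite /sep enorm2_convex; lra. Qed.

Lemma sep_is_primal : 0 <= mu -> is_primal sep sep_primal.
Proof.
move=> mu0 x; split.
  exists 0 => //; rewrite /sep [enorm2 _]big1 ?mulr0 ?subr0// => i _.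
  by rewrite mxE expr0n.
by move=> _ [y _ <-]; rewrite /sep gerBl mulr_ge0 ?enorm2_ge0// divr_ge0.
Qed.

(** If the first step does not move away from the minimizer, the gap depends on [x0] alone, so one
    initialization fits both methods and all step sizes. *)
Lemma sep_is_gap x0 x1 : `|x1 0 0| <= `|x0 0 0| ->
  is_gap sep_primal x0 x1 (sep_primal x0).
Proof.
move=> x10; exists 0.
  split; first by exists 0 => //; rewrite /sep_primal mxE soft_abs0.
  by move=> _ [x _ <-]; rewrite soft_abs_ge0// ltW.
by rewrite subr0; apply/esym/max_idPr; rewrite ler_soft_abs// ltW.
Qed.

Lemma enorm_gradient_sep_primal x :
  enorm (gradient sep_primal x) = `|soft_slope A a (x 0 0)|.
Proof.
by rewrite gradient_sep_primal /enorm enorm2Z enorm2_delta mulr1 sqrtr_sqr.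
Qed.

Lemma gradx_sep_bound x y : `|gradx sep x y 0 0| <= A.
Proof. by rewrite gradx_sep !mxE !eqxx mulr1 soft_slope_bound// ltW. Qed.

(** The travel argument for any sequence whose first coordinate moves by at most [r] per step. Since
    [eps = A / 2], a small gradient forces that coordinate below [a]. *)
Lemma sep_needs_iterations (z : nat -> 'rV[R]_m.+1 * 'rV[R]_n) (eps r B : R) :
  A = 2 * eps -> 0 < r -> B * r <= (z 0%N).1 0 0 - a ->
  (forall t, `|(z t.+1).1 0 0 - (z t).1 0 0| <= r) ->
  needs_iterations sep_primal z eps B.
Proof.
move=> Aeps r0 Br step T _ [t /andP[_ tT] ->].
rewrite enorm_gradient_sep_primal => small.
have {small} : `|(z t).1 0 0| <= a.
  by apply: (@soft_slope_small _ A) => //; move: small; rewrite Aeps; lra.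
rewrite ler_norml => /andP[_ zta].
have travel s : (z 0%N).1 0 0 - (z s).1 0 0 <= s%:R * r.
  elim: s => [|s IH]; first by rewrite mul0r subrr.
  by have := step s; rewrite ler_norml -natr1 => /andP[]; lra.
rewrite -(ler_pM2r r0); have := travel t.
have : t%:R * r <= T%:R * r by rewrite ler_pM2r// ler_nat.
by lra.
Qed.

End Separable.

(** * Length of one iteration of each method *)

Section Steps.
Context {R : realType} {m n : nat}.
Variables (f : 'rV[R]_m.+1 -> 'rV[R]_n -> R) (ex ey A : R).
Variables (x0 : 'rV[R]_m.+1) (y0 : 'rV[R]_n).
Hypotheses (ex0 : 0 < ex) (gA : forall x y, `|gradx f x y 0 0| <= A).

Lemma ogda_step_bound t :
  `|(ogda f ex ey x0 y0 t.+1).1 0 0 - (ogda f ex ey x0 y0 t).1 0 0|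
  <= 3 * A * ex.
Proof.
rewrite /ogda iterS; case: (iter t _ _) => [[x y] [xp yp]] /=.
move: (gA x y) (gA xp yp); move: (gradx f x y) (gradx f xp yp) => G Gp.
rewrite !mxE; move: (G 0 0) (Gp 0 0) => g gp.
rewrite (ler_norml g) (ler_norml gp) => /andP[? ?] /andP[? ?].
(* Optimism doubles the current gradient and subtracts the previous one, whence the factor 3. *)
rewrite (_ : _ - _ = - (ex * (2 * g - gp))); last by ring.
rewrite normrN normrM (gtr0_norm ex0) mulrC ler_pM2r// ler_norml.
by apply/andP; split; lra.
Qed.

Lemma eg_step_bound t :
  `|(eg f ex ey x0 y0 t.+1).1 0 0 - (eg f ex ey x0 y0 t).1 0 0| <= A * ex.
Proof.
rewrite /eg iterS; case: (iter t _ _) => [x y] /=.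
move: (gradx f _ _) (gA (x - ex *: gradx f x y) (y + ey *: grady f x y)) => G gG.
rewrite !mxE (_ : _ - _ = - (ex * G 0 0)); last by ring.
by rewrite normrN normrM (gtr0_norm ex0) mulrC ler_pM2r.
Qed.

End Steps.

(** * Choice of parameters and assembly of the lower bound *)

Theorem theorem4p6 (R : realType) (l : R) (l_gt0 : 0 < l) :
  exists2 c : R, 0 < c &
  forall (m n : nat) (mu Delta : R),
    (0 < m)%N -> (0 < n)%N -> 0 < mu -> mu <= l -> 0 < Delta ->
  let kappa := l / mu in
  exists2 eps0 : R, 0 < eps0 &
  forall eps : R, 0 < eps -> eps < eps0 ->
  exists (f : 'rV[R]_m -> 'rV[R]_n -> R) (Phi : 'rV[R]_m -> R)
         (x0 : 'rV[R]_m) (y0 : 'rV[R]_n),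
    [/\ smooth l f,
        forall x, strongly_concave mu (f x),
        is_primal f Phi,
        forall etax : R, 0 < etax -> etax <= 1 / (50 * kappa ^+ 2 * l) ->
          let z := ogda f etax (1 / (6 * l)) x0 y0 in
          is_gap Phi (z 0%N).1 (z 1%N).1 Delta /\
          needs_iterations Phi z eps (c * (kappa ^+ 2 * Delta / eps ^+ 2)) &
        forall etax : R, 0 < etax -> etax <= 1 / (75 * kappa ^+ 2 * l) ->
          let z := eg f etax (1 / (4 * l)) x0 y0 in
          is_gap Phi (z 0%N).1 (z 1%N).1 Delta /\
          needs_iterations Phi z eps (c * (kappa ^+ 2 * Delta / eps ^+ 2))].
Proof.
exists l => // m n mu D; case: m => // m _ _ mu0 mul D0 k.
have k1 : 1 <= k ^+ 2 by rewrite exprn_ege1// /k ler_pdivlMr// mul1r.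
have kl : 0 < k ^+ 2 * l by rewrite mulr_gt0// (lt_le_trans ltr01).
(* Chosen so that [2 * a <= D / A], that is [8 * eps ^+ 2 <= D * l]: the flat region then takes up
   at most half of the distance. *)
exists (Num.sqrt (D * l / 8)); first by rewrite sqrtr_gt0 divr_gt0 ?mulr_gt0.
move=> eps eps_gt0 eps_small.
have {eps_small} eps2 : 8 * eps ^+ 2 <= D * l.
  move: eps_small; rewrite -{1}(gtr0_norm eps_gt0) -sqrtr_sqr.
  by rewrite ltr_sqrt ?divr_gt0 ?mulr_gt0//; lra.
pose A := 2 * eps; pose a := 2 * eps / l.
have A0 : 0 < A by rewrite mulr_gt0.
have a0 : 0 < a by rewrite divr_gt0.
have Aa : A / a = l by rewrite /A /a; field; rewrite !gt_eqF.
have al : a * l = A by rewrite /a divfK ?gt_eqF.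
have [s0 s0D s0E] := soft_abs_preimage A0 a0 D0.
have aD : 2 * a <= D / A.
  rewrite ler_pdivlMr// -(ler_pM2r l_gt0).
  have -> : 2 * a * A * l = 2 * (a * l) * A by ring.
  by rewrite al /A; lra.
(* Both methods use eta <= 1 / (50 kappa^2 l): the descent then has to cover
   the distance s0 - a >= D / (2 A) in steps of length at most 3 A eta. *)
have rate e : 0 < e -> e <= 1 / (50 * k ^+ 2 * l) ->
    l * (k ^+ 2 * D / eps ^+ 2) * (3 * A * e) <= s0 - a /\ A * e <= a.
  move=> e0; rewrite ler_pdivlMr; last by rewrite -mulrA mulr_gt0.
  move=> ek; split.
    apply: (@le_trans _ _ (D / A / 2)); last by lra.
    rewrite (_ : D / A / 2 = D / eps * (1 / 4)); last first.
      by rewrite /A; field; rewrite gt_eqF.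
    rewrite (_ : _ * (3 * A * e) = D / eps * (6 * (e * (k ^+ 2 * l)))); last first.
      by rewrite /A; field; rewrite gt_eqF.
    by rewrite ler_pM2l ?divr_gt0//; lra.
  (* As [k ^+ 2 >= 1], the step-size bound gives [l * e <= 1]. *)
  rewrite -al -mulrA ler_piMr ?(ltW a0)//.
  have : l * e * 1 <= l * e * k ^+ 2 by rewrite ler_pM2l ?mulr_gt0.
  have : 0 < l * e by rewrite mulr_gt0.
  by lra.
exists (sep A a mu), (sep_primal A a), (const_mx s0), 0.
have x0E : sep_primal A a (const_mx s0 : 'rV_m.+1) = D.
  by rewrite /sep_primal mxE.
have gA : forall x y, `|gradx (sep A a mu : 'rV_m.+1 -> 'rV_n -> R) x y 0 0| <= A.
  by move=> x y; exact: gradx_sep_bound.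
(* The slope is taken at a separate point [s] because EG evaluates it at the half step. The move is
   at most [A * e <= a <= s0], so it cannot overshoot 0. *)
have first_step e s : 0 < e -> e <= 1 / (50 * k ^+ 2 * l) -> 0 <= s ->
    `|s0 - e * soft_slope A a s| <= `|s0|.
  move=> e0 /(rate e e0)[_ eA] s_ge0.
  have := soft_slope_bound s (ltW A0) a0; rewrite ler_norml => /andP[_ gs].
  have g0 : 0 <= soft_slope A a s.
    by rewrite divr_ge0 ?mulr_ge0// ltW// hyp_gt0.
  have : e * soft_slope A a s <= e * A by rewrite ler_pM2l.
  have : 0 <= e * soft_slope A a s by rewrite mulr_ge0// ltW.
  by move=> ? ?; rewrite !ger0_norm; lra.
split.
- by apply: sep_smooth => //; rewrite mul ltW.
- exact: sep_strongly_concave.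
- by apply: sep_is_primal; exact: ltW.
- move=> e e0 ek z; have [Be eA] := rate e e0 ek; split.
    rewrite -x0E; apply: sep_is_gap => //=.
    (* The optimistic correction vanishes at the first step, where the previous iterate equals the
       current one. *)
    rewrite subrr scaler0 subr0 gradx_sep// !mxE !eqxx mulr1.
    by apply: first_step => //; lra.
  apply: (@sep_needs_iterations _ _ _ _ _ _ _ _ _ (3 * A * e)) => //.
  + by rewrite !mulr_gt0.
  + by rewrite mxE.
  + by move=> t; exact: ogda_step_bound.
- move=> e e0 ek z.
  have {}ek : e <= 1 / (50 * k ^+ 2 * l).
    apply: le_trans ek _; rewrite ler_pM2l ?ltr01//.
    by rewrite -(mulrA 75) -(mulrA 50) lef_pV2 ?posrE; lra.
  have [Be eA] := rate e e0 ek; split.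
    rewrite -x0E; apply: sep_is_gap => //=.
    rewrite !gradx_sep// !mxE !eqxx !mulr1.
    apply: first_step => //.
    (* It remains to see that the half step of EG stays nonnegative. *)
    have := soft_slope_bound s0 (ltW A0) a0; rewrite ler_norml => /andP[_ gs].
    have : e * soft_slope A a s0 <= e * A by rewrite ler_pM2l.
    by lra.
  apply: (@sep_needs_iterations _ _ _ _ _ _ _ _ _ (3 * A * e)) => //.
  + by rewrite !mulr_gt0.
  + by rewrite mxE.
  (* The EG step bound is relaxed to that of OGDA so that [rate] serves both. *)
  + move=> t; apply: le_trans (eg_step_bound _ _ _ e0 gA t) _.
    by rewrite ler_pM2r//; lra.
Qed.
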